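(* Let $F$ be a positive integer. Let $\mathrm{G}(F)$ be the graph whose set of vertices is $\mathrm{Arf}(F)$ and in which $(S,T)\in\mathrm{Arf}(F)\times\mathrm{Arf}(F)$ is an edge if and only if $T=S\setminus\{\mathrm{m}(S)\}$. Then $\mathrm{G}(F)$ is a tree with root $\Delta(F)=\{0\}\cup\{n\in\mathbb{N}\mid n\ge F+1\}$.
   Context: $\mathbb{N}$ denotes the set of nonnegative integers. A numerical semigroup is a subset $S\subseteq\mathbb{N}$ that contains $0$, is closed under addition, and has finite complement in $\mathbb{N}$. The multiplicity is $\mathrm{m}(S)=\min(S\setminus\{0\})$, and the Frobenius number $\mathrm{F}(S)$ is the greatest integer not in $S$. An A-semigroup (Arf numerical semigroup) is a numerical semigroup $S$ such that $x+y-z\in S$ for all $x,y,z\in S$ with $x\ge y\ge z$. For a positive integer $F$, $\mathrm{Arf}(F)$ is the set of A-semigroups with Frobenius number $F$. A graph is a pair $(V,E)$ with $V$ a nonempty set (vertices) and $E\subseteq\{(u,v)\in V\times V\mid u\ne v\}$ (edges). A path of length $n$ connecting the vertices $x$ and $y$ is a sequence of different edges of the form $(v_0,v_1),(v_1,v_2),\dots,(v_{n-1},v_n)$ with $v_0=x$ and $v_n=y$. A graph is a tree with root $r$ if $r$ is a vertex such that for any other vertex $x$ there exists a unique path connecting $x$ and $r$. *)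

(* Defs.v *)
From mathcomp Require Import all_boot all_order all_algebra.
From mathcomp Require Import boolp classical_sets cardinality.

Set Implicit Arguments.
Unset Strict Implicit.
Unset Printing Implicit Defensive.

Local Open Scope classical_set_scope.
Local Open Scope nat_scope.

Definition numerical_semigroup (S : set nat) : Prop :=
  [/\ S 0,
      (forall x y, S x -> S y -> S (x + y)) &
      finite_set (~` S)].

Definition least {d} {T : porderType d} (A : set T) : set T :=
  A `&` lbound A.

Definition greatest {d} {T : porderType d} (A : set T) : set T :=
  A `&` ubound A.

(* The default value 0 is never used when S is a numerical semigroup. *)
Definition multiplicity (S : set nat) : nat := xget 0 (least (S `\ 0)).

(* The maximum is taken over the integers, so that the Frobenius number of
   setT is -1; the default value is never used when S is a numerical
   semigroup. *)
Definition frobenius (S : set nat) : int :=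
  xget (-1)%R (greatest (~` (Posz @` S))).

(* The subtraction is not truncated, since z <= y. *)
Definition A_semigroup (S : set nat) : Prop :=
  numerical_semigroup S /\
  forall x y z, S x -> S y -> S z -> z <= y -> y <= x -> S (x + y - z).

Definition Arf (F : nat) : set (set nat) :=
  [set S | A_semigroup S /\ frobenius S = (F%:Z)%R].

Record pregraph (V : Type) := Pregraph {
  vertices : set V;
  edges : set (V * V)
}.

Definition is_graph (V : Type) (G : pregraph V) : Prop :=
  vertices G !=set0 /\
  edges G `<=` [set e | [/\ vertices G e.1, vertices G e.2 & e.1 <> e.2]].

(* A path is the sequence p of its edges, which have to be pairwise different;
   only the values v 0, ..., v n matter. *)
Definition is_path (V : eqType) (G : pregraph V) (x y : V) (n : nat)
    (p : seq (V * V)) : Prop :=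
  exists v : nat -> V,
    [/\ v 0 = x, v n = y, p = [seq (v i, v i.+1) | i <- iota 0 n],
        (forall e, e \in p -> edges G e) & uniq p].

Definition is_tree_with_root (V : eqType) (G : pregraph V) (r : V) : Prop :=
  [/\ is_graph G, vertices G r &
      forall x, vertices G x -> x <> r ->
        exists! p : seq (V * V), exists n, is_path G x r n p].

Definition ArfGraph (F : nat) : pregraph (set nat) :=
  {| vertices := Arf F;
     edges := [set e | [/\ Arf F e.1, Arf F e.2 &
                           e.2 = e.1 `\ multiplicity e.1]] |}.

Definition Delta (F : nat) : set nat := [set 0] `|` [set n | F + 1 <= n].

(* Main.v *)
Require Import Defs.
From mathcomp Require Import all_boot all_order all_algebra.
From mathcomp Require Import boolp classical_sets cardinality.

Set Implicit Arguments.
Unset Strict Implicit.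
Unset Printing Implicit Defensive.

(** The edges of [ArfGraph F] are functional: the only possible edge out of [S]
    goes to [S] without its multiplicity, so a path is determined by its source
    and its length.  Three facts about [Arf F] turn this into a rooted tree.
    - If [S] differs from [Delta F], then [S] has a positive element below [F],
      so its multiplicity is below [F]; removing it changes neither the
      Frobenius number nor the Arf property ([edge_to_remove_multiplicity]).
      Hence every vertex other than [Delta F] has an outgoing edge.
    - The multiplicity of [Delta F] is [F + 1], and removing it raises the
      Frobenius number; so [Delta F] is a sink ([Delta_sink]).
    - The multiplicity increases strictly along an edge and never exceeds
      [F + 1] on [Arf F], so the difference [F + 1 - m(S)] decreases
      ([edge_decreases]).  Thus following edges must stop, and can only stop at
      [Delta F]; moreover no edge is met twice.
    Two paths from the same vertex to [Delta F] follow the same edges, and none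
    of them can go on after reaching the sink, so they coincide.  This graph
    argument is [functional_graph_tree]. *)

Local Open Scope classical_set_scope.
Local Open Scope nat_scope.

(** * Functional graphs with a single sink *)

Section FunctionalGraph.
Variables (V : eqType) (G : pregraph V) (r : V) (next : V -> V) (mu : V -> nat).
Hypothesis r_vertex : vertices G r.
Hypothesis edge_vertices :
  forall x y, edges G (x, y) -> vertices G x /\ vertices G y.
Hypothesis edge_next : forall x y, edges G (x, y) -> y = next x.
Hypothesis next_edge :
  forall x, vertices G x -> x <> r -> edges G (x, next x).
Hypothesis sink : forall y, ~ edges G (r, y).
Hypothesis edge_mu : forall x y, edges G (x, y) -> mu y < mu x.

Lemma edges_along (v : nat -> V) n :
  (forall e, e \in [seq (v i, v i.+1) | i <- iota 0 n] -> edges G e) <->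
  (forall i, i < n -> edges G (v i, v i.+1)).
Proof.
split=> [H i lt_in | H e /mapP[i]].
  by apply: H; apply/mapP; exists i; rewrite // mem_iota.
by rewrite mem_iota => lt_in ->; apply: H.
Qed.

Lemma walk_iter (v : nat -> V) n :
  (forall i, i < n -> edges G (v i, v i.+1)) ->
  forall i, i <= n -> v i = iter i next (v 0).
Proof.
move=> edge_v; elim=> [|i IHi] lt_in //=.
by rewrite -IHi ?(ltnW lt_in) //; apply/edge_next/edge_v.
Qed.

Lemma walk_mu (v : nat -> V) n :
  (forall i, i < n -> edges G (v i, v i.+1)) ->
  forall i j, i < j -> j <= n -> mu (v j) < mu (v i).
Proof.
move=> edge_v i; elim=> // j IHj; rewrite ltnS leq_eqVlt.
case/predU1P=> [-> | lt_ij] lt_jn; first exact/edge_mu/edge_v.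
exact: ltn_trans (edge_mu (edge_v _ lt_jn)) (IHj lt_ij (ltnW lt_jn)).
Qed.

(** A walk repeats no edge, because [mu] separates the sources of its edges. *)
Lemma walk_uniq (v : nat -> V) n :
  (forall i, i < n -> edges G (v i, v i.+1)) ->
  uniq [seq (v i, v i.+1) | i <- iota 0 n].
Proof.
move=> edge_v; rewrite map_inj_in_uniq ?iota_uniq // => i j.
rewrite !mem_iota /= add0n => lt_in lt_jn [eq_v _].
case: (ltngtP i j) => // [lt_ij | lt_ji].
  by have := walk_mu edge_v lt_ij (ltnW lt_jn); rewrite eq_v ltnn.
by have := walk_mu edge_v lt_ji (ltnW lt_in); rewrite eq_v ltnn.
Qed.

(** Iterating [next] cannot go on forever, since [mu] decreases, and it can
    only be stuck at the sink. *)
Lemma walk_to_sink x : vertices G x ->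
  exists n, iter n next x = r /\
    forall i, i < n -> edges G (iter i next x, iter i.+1 next x).
Proof.
have [k] := ubnP (mu x); elim: k x => // k IHk x lt_xk Vx.
have [-> | /eqP x_neq_r] := eqVneq x r; first by exists 0.
have edge_x := next_edge Vx x_neq_r.
have lt_nk : mu (next x) < k by apply: leq_trans (edge_mu edge_x) _.
have [n [end_n edge_n]] := IHk _ lt_nk (edge_vertices edge_x).2.
exists n.+1; split=> [|[|i] lt_in] //; first by rewrite iterSr.
by rewrite iterSr (iterSr i.+1); exact: edge_n.
Qed.

(** The end of a walk to the sink is final, so it determines the length. *)
Lemma walk_length_le (v w : nat -> V) n k :
  (forall i, i < n -> edges G (v i, v i.+1)) ->
  (forall i, i < k -> edges G (w i, w i.+1)) ->
  v 0 = w 0 -> v n = r -> k <= n.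
Proof.
move=> edge_v edge_w eq0 end_v; rewrite leqNgt; apply/negP=> lt_nk.
apply: (@sink (w n.+1)); rewrite -end_v (walk_iter edge_v (leqnn n)) eq0.
by rewrite -(walk_iter edge_w (ltnW lt_nk)); exact: edge_w.
Qed.

Lemma functional_graph_tree : is_tree_with_root G r.
Proof.
split=> // [|x Vx x_neq_r].
  split=> [|[x y] /= edge_xy]; first by exists r.
  have [Vx Vy] := edge_vertices edge_xy; split=> // eq_xy.
  by have := edge_mu edge_xy; rewrite eq_xy ltnn.
have [n [end_n edge_n]] := walk_to_sink Vx.
exists [seq (iter i next x, iter i.+1 next x) | i <- iota 0 n]; split.
  exists n, (fun i => iter i next x); split=> //; last exact: walk_uniq.
  exact/edges_along.
move=> q [k [w [w0 wk -> /edges_along edge_w _]]].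
have eq_nk : n = k.
  apply/eqP; rewrite eqn_leq (walk_length_le edge_w edge_n w0 wk) /=.
  exact: (walk_length_le (v := fun i => iter i next x) edge_n edge_w).
rewrite eq_nk; apply/eq_in_map=> i; rewrite mem_iota add0n => lt_ik.
by rewrite -w0 -(walk_iter edge_w lt_ik) -(walk_iter edge_w (ltnW lt_ik)).
Qed.

End FunctionalGraph.

(** * Multiplicity and Frobenius number *)

Lemma multiplicityP (S : set nat) n : S n -> 0 < n ->
  [/\ S (multiplicity S), 0 < multiplicity S &
      forall k, S k -> 0 < k -> multiplicity S <= k].
Proof.
move=> Sn n_gt0; rewrite /multiplicity.
have exS : exists k, `[< S k >] && (0 < k) by exists n; rewrite asboolT.
case: xgetP => [m _ [[Sm /eqP m_neq0] m_min] | no_least].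
  split=> //; first by rewrite lt0n.
  move=> k Sk k_gt0; apply: m_min; split=> //=.
  by move=> k0; rewrite k0 in k_gt0.
case: (ex_minnP exS) => m /andP[/asboolP Sm m_gt0] m_min.
case: (no_least m); split=> [|k [Sk /eqP k_neq0]].
  by split=> // m0; rewrite m0 in m_gt0.
by apply: m_min; rewrite asboolT // lt0n.
Qed.

Lemma frobeniusP (S : set nat) (F : nat) :
  frobenius S = F%:Z%R <-> ~ S F /\ forall n, F < n -> S n.
Proof.
have greatestP : greatest (~` (Posz @` S)) F%:Z%R <->
    ~ S F /\ forall n, F < n -> S n.
  split=> [[notSF F_max] | [notSF S_gtF]].
    split=> [SF | n lt_Fn]; first by apply: notSF; exists F.
    apply: contrapT => notSn.
    have /F_max : (~` (Posz @` S)) n%:Z%R by case=> k Sk [eq_kn]; rewrite -eq_kn in notSn.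
    by rewrite lez_nat leqNgt lt_Fn.
  split=> [[k Sk [eq_kF]] | [n | n] notSn]; first by rewrite -eq_kF in notSF.
    rewrite lez_nat leqNgt; apply/negP=> lt_Fn.
    by apply: notSn; exists n => //; exact: S_gtF.
  by [].
rewrite -greatestP /frobenius; split=> [|F_greatest].
  by case: xgetP => [z _ z_greatest <- // | _].
apply: xget_subset1 => // x y [x_in x_max] [y_in y_max].
by apply/eqP; rewrite Order.POrderTheory.eq_le x_max ?y_max.
Qed.

(** * Arf semigroups with a given Frobenius number *)

Section ArfGraph.
Variable F : nat.

(** Containing everything above [F] already makes the complement finite, so
    membership in [Arf F] is a purely arithmetical condition. Additive closure
    is the instance [z = 0] of the Arf condition. *)
Lemma ArfP (S : set nat) :
  Arf F S <->
  [/\ S 0, ~ S F, forall n, F < n -> S n &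
      forall x y z, S x -> S y -> S z -> z <= y -> y <= x -> S (x + y - z)].
Proof.
split=> [[[[S0 _ _] arf] /frobeniusP[]] // | [S0 notSF S_gtF arf]].
split; last exact/frobeniusP.
split=> //; split=> // [x y Sx Sy|].
  case: (leqP y x) => [le_yx | /ltnW le_xy].
    by rewrite -[x + y]subn0; apply: arf.
  by rewrite addnC -[y + x]subn0; apply: arf.
apply: sub_finite_set (finite_II F.+1) => n /= notSn.
by rewrite ltnS leqNgt; apply/negP=> /S_gtF.
Qed.

Lemma multiplicityArfP {S : set nat} : Arf F S ->
  [/\ S (multiplicity S), 0 < multiplicity S &
      forall k, S k -> 0 < k -> multiplicity S <= k].
Proof. by case/ArfP=> _ _ S_gtF _; exact: (@multiplicityP _ F.+1 (S_gtF _ _)). Qed.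

Lemma multiplicityArf_le {S : set nat} : Arf F S -> multiplicity S <= F.+1.
Proof.
move=> S_Arf; have [_ _ m_min] := multiplicityArfP S_Arf.
by case/ArfP: S_Arf => _ _ S_gtF _; apply: m_min => //; exact: S_gtF.
Qed.

Lemma multiplicityArf_lt {S : set nat} :
  Arf F S -> S <> Delta F -> multiplicity S < F.
Proof.
move=> S_Arf S_neq; have [Sm m_gt0 m_min] := multiplicityArfP S_Arf.
case/ArfP: S_Arf => S0 notSF S_gtF _.
rewrite ltnNge leq_eqVlt; apply/negP=> /predU1P[F_m | lt_Fm].
  by rewrite F_m in notSF.
apply: S_neq; rewrite predeqE => n; rewrite /Delta /= addn1.
split=> [Sn | [-> // | /S_gtF //]].
have [-> | n_gt0] := posnP n; first by left.
by right; apply: leq_trans lt_Fm (m_min _ Sn n_gt0).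
Qed.

(** A value [x + y - z] equal to the multiplicity [m] would be at least [x];
    as [x] is not [m], it would be zero, and so would [y] and [z]. *)
Lemma edge_to_remove_multiplicity (S : set nat) :
  Arf F S -> S <> Delta F -> edges (ArfGraph F) (S, S `\ multiplicity S).
Proof.
move=> S_Arf S_neq; split=> //=.
have [Sm m_gt0 m_min] := multiplicityArfP S_Arf.
have lt_mF := multiplicityArf_lt S_Arf S_neq.
case/ArfP: S_Arf => S0 notSF S_gtF arf.
apply/ArfP; split=> [||n lt_Fn|x y z [Sx x_neq] [Sy _] [Sz _] le_zy le_yx].
- by split=> //= m0; rewrite -m0 in m_gt0.
- by case.
- by split=> [|/= n_m]; [exact: S_gtF | rewrite n_m ltnNge ltnW in lt_Fn].
split=> [|/= xyz_m]; first exact: arf.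
have le_xm : x <= multiplicity S by rewrite -xyz_m -addnBA // leq_addr.
have [x0 | x_gt0] := posnP x.
  have y0 : y = 0 by apply/eqP; rewrite -leqn0 -x0.
  by rewrite -xyz_m x0 y0 in m_gt0.
by apply: x_neq; apply/eqP; rewrite eqn_leq le_xm m_min.
Qed.

Lemma edge_decreases (S T : set nat) : edges (ArfGraph F) (S, T) ->
  F.+1 - multiplicity T < F.+1 - multiplicity S.
Proof.
case=> /= S_Arf T_Arf eqT.
have [_ _ m_min] := multiplicityArfP S_Arf.
have [Tm Tm_gt0 _] := multiplicityArfP T_Arf.
have lt_m : multiplicity S < multiplicity T.
  move: Tm; rewrite {1}eqT => -[Sm /eqP neq].
  by rewrite ltn_neqAle eq_sym neq m_min.
by apply: ltn_sub2l => //; exact: leq_trans lt_m (multiplicityArf_le T_Arf).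
Qed.

(** For [F = 0] the set [Delta F] is all of [nat], and [F] belongs to it. *)
Lemma Delta_Arf : 0 < F -> Arf F (Delta F).
Proof.
move=> F_gt0; apply/ArfP; split; rewrite /Delta /=.
- by left.
- by rewrite addn1 ltnn => -[F0 | //]; rewrite F0 in F_gt0.
- by move=> n; rewrite addn1; right.
move=> x y z Dx _ _ le_zy le_yx; case: Dx => [x0 | lt_Fx].
  by left; move: le_yx; rewrite x0 leqn0 => /eqP->.
by right; rewrite -addnBA //; apply: leq_trans lt_Fx (leq_addr _ _).
Qed.

Lemma Delta_sink (T : set nat) : ~ edges (ArfGraph F) (Delta F, T).
Proof.
case=> /= D_Arf /ArfP[_ _ T_gtF _] eqT.
have [Dm m_gt0 _] := multiplicityArfP D_Arf.
case: Dm => [m0 | ]; first by rewrite m0 in m_gt0.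
by rewrite /= addn1 => /T_gtF; rewrite {1}eqT => -[_ /(_ erefl)].
Qed.

End ArfGraph.

Theorem proposition3p1 (F : nat) (hF : (0 < F)%N) :
  is_tree_with_root (ArfGraph F) (Delta F).
Proof.
apply: (@functional_graph_tree _ _ _ (fun S => S `\ multiplicity S)
          (fun S => F.+1 - multiplicity S)).
- exact: Delta_Arf.
- by move=> S T [].
- by move=> S T [].
- exact: edge_to_remove_multiplicity.
- exact: Delta_sink.
- exact: edge_decreases.
Qed.
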